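(* For each integer $k\geq 3$, there exists a simple connected $k$-regular graph $X$ with no separating transitions such that the line graph $L(X)$ has no Hamilton decomposition.
   Context: A transition at a vertex $u$ of a graph $X$ is a pair of half-edges incident with $u$. If $t$ is a transition at $u$, then $X^t$ denotes the graph obtained from $X$ by splitting $u$ into two new vertices $u_1$ and $u_2$, joining the two half-edges of $t$ to $u_1$, and joining every other half-edge at $u$ to $u_2$. A transition $t$ is separating if $X^t$ has more connected components than $X$. If a graph is regular of degree $2m$ or $2m+1$, a Hamilton decomposition of it is a set of $m$ pairwise edge-disjoint Hamilton cycles. The line graph $L(X)$ has the edges of $X$ as vertices, two being adjacent when they share an endpoint in $X$. *)

(* Defs.v *)
From HB Require Import structures.
From mathcomp Require Import all_boot.

Set Implicit Arguments.
Unset Strict Implicit.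
Unset Printing Implicit Defensive.

(* Finite simple graphs. *)
Record sgraph := SGraph {
  vertex :> finType;
  adj : rel vertex;
  adj_sym : symmetric adj;
  adj_irr : irreflexive adj }.

Definition regular (d : nat) (G : sgraph) : Prop :=
  forall x : G, #|[set y | adj x y]| = d.

Definition components (G : sgraph) : nat := n_comp (@adj G) predT.

(* In particular the graph without vertices is not connected. *)
Definition connected (G : sgraph) : Prop := components G = 1.

Definition edges (G : sgraph) : {set {set G}} :=
  [set [set p.1; p.2] | p : G * G & adj p.1 p.2].

(* The half of the edge {u, v} that is incident with u is encoded as (u, v);
   its other half is (v, u). *)
Definition half_edges (G : sgraph) (u : G) : {set G * G} :=
  [set h | (h.1 == u) && adj h.1 h.2].

Definition transition (G : sgraph) (u : G) (t : {set G * G}) : Prop :=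
  t \subset half_edges u /\ #|t| = 2.

Section Split.
Variables (G : sgraph) (u : G) (t : {set G * G}).

(* The vertex of the split graph to which a half-edge is joined: [None] stands
   for u_1, [Some u] for u_2 and [Some x] for any other vertex x. *)
Definition split_end (h : G * G) : option G :=
  if (h.1 == u) && (h \in t) then None else Some h.1.

Definition split_adj : rel (option G) := fun a b =>
  [exists x : G, exists y : G,
    [&& adj x y, a == split_end (x, y) & b == split_end (y, x)]].

Lemma split_adj_sym : symmetric split_adj.
Proof.
suff sub a b : split_adj a b -> split_adj b a.
  by move=> a b; apply/idP/idP; apply: sub.
rewrite /split_adj => /existsP[x /existsP[y /and3P[xy ax bx]]].
apply/existsP; exists y => /=; apply/existsP; exists x.
by rewrite adj_sym xy bx ax.
Qed.

Lemma split_adj_irr : irreflexive split_adj.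
Proof.
move=> a; apply/negbTE/negP => /existsP[x /existsP[y]].
case/and3P=> xy /eqP-> /eqP.
have nxy : x <> y by move=> exy; rewrite exy adj_irr in xy.
rewrite /split_end /=.
case: ifP => [/andP[/eqP xu _]|_]; case: ifP => [/andP[/eqP yu _]|_] //.
- by case: nxy; rewrite xu yu.
- by case.
Qed.

Definition split_graph : sgraph := SGraph split_adj_sym split_adj_irr.
End Split.

Definition separating (G : sgraph) (u : G) (t : {set G * G}) : Prop :=
  components G < components (split_graph u t).

Section LineGraph.
Variable G : sgraph.

Definition line_vertex : finType := {e : {set G} | e \in edges G}.

Definition line_adj : rel line_vertex := fun e f =>
  (e != f) && (val e :&: val f != set0).

Lemma line_adj_sym : symmetric line_adj.
Proof. by move=> e f; rewrite /line_adj eq_sym setIC. Qed.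

Lemma line_adj_irr : irreflexive line_adj.
Proof. by move=> e; rewrite /line_adj eqxx. Qed.

Definition line_graph : sgraph := SGraph line_adj_sym line_adj_irr.
End LineGraph.

(* A Hamilton cycle is given by its edge set, so that the starting vertex and
   the direction of traversal s do not matter. *)
Definition hamilton_cycle (G : sgraph) (C : {set {set G}}) : Prop :=
  exists s : seq G,
    [/\ 2 < size s, uniq s, forall x, x \in s, cycle (@adj G) s
      & C = [set [set x; next s x] | x in s]].

Definition hamilton_decomposition (G : sgraph) (D : {set {set {set G}}}) :
    Prop :=
  exists m : nat,
    [/\ regular m.*2 G \/ regular m.*2.+1 G, #|D| = m, trivIset D
      & forall C, C \in D -> hamilton_cycle C].

(* Main.v *)
(* X is a necklace: k hubs are placed on a ring; hub l is joined to a clique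
   K_k on its left by k - 2 edges, and on its right by two edges to two gadgets
   (each a K_{k+1} minus an edge), both of which have one edge to the next
   clique.  X is 2-connected, so no transition is separating, k being >= 3.

   Each gadget is attached by a 2-edge-cut, so a Hamilton cycle of L(X) runs
   straight through the two edges of this cut.  If it moreover uses the edge of
   L(X) between the two right edges of hub l, then it never crosses from the
   left to the right of that hub; doing so at two hubs would disconnect it.  A
   Hamilton decomposition consists of k - 1 cycles covering all edges of L(X),
   in particular those k edges of L(X), which contradicts the pigeonhole
   principle. *)
Require Import Defs.
From mathcomp Require Import all_boot zify.

Set Implicit Arguments.
Unset Strict Implicit.
Unset Printing Implicit Defensive.

Lemma set2_eq (T : finType) (x y z w : T) :
  [set x; y] = [set z; w] -> x = z /\ y = w \/ x = w /\ y = z.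
Proof.
move=> /setP eq_xyzw.
have := (eq_xyzw x, eq_xyzw y, eq_xyzw z, eq_xyzw w).
rewrite !inE !eqxx !orbT /=.
case=> [[[]]]; case/esym/orP=> /eqP<-; case/esym/orP=> /eqP<-;
  rewrite ?eqxx ?orbb; auto.
- by move=> _ /eqP->; auto.
- by move=> /eqP->; auto.
Qed.

(** * Hamilton cycles as edge sets *)

Section HamiltonCycle.
Variables (G : sgraph) (C : {set {set G}}).
Hypothesis hamC : hamilton_cycle C.

Lemma ham_cycle_adj x y : [set x; y] \in C -> adj x y.
Proof.
case: hamC => s [_ _ s_all s_cycle ->] /imsetP[z _ /set2_eq].
have zz : adj z (next s z) by apply: next_cycle.
by case=> [[-> ->]|[-> ->]] //; rewrite adj_sym.
Qed.

(** The neighbours of [x] in [C] are [next s x] and [prev s x]. If they coincided, two steps along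
    [s] would lead from [x] back to [x], impossible with more than two distinct vertices. *)
Lemma ham_cycle_degree x : #|[set y | [set x; y] \in C]| = 2.
Proof.
case: hamC => s [s_gt2 s_uniq s_all _ ->].
have -> : [set y | [set x; y] \in [set [set z; next s z] | z in s]]
    = [set next s x; prev s x].
  apply/setP=> y; rewrite !inE; apply/imsetP/orP => [[z _ /set2_eq]|].
    by case=> [[-> ->]|[-> ->]]; [left | right; rewrite prev_next].
  case=> /eqP->; first by exists x.
  by exists (prev s x) => //; rewrite next_prev // setUC.
rewrite cards2; have [eq_np|//] := eqVneq.
have : next s (next s x) = x by rewrite eq_np next_prev.
have [i s' def_s'] := rot_to (s_all x).
rewrite -!(next_rot i s_uniq) def_s'.
move: s_gt2 s_uniq; rewrite -(size_rot i) -(rot_uniq i) def_s'.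
case: s' {def_s'} => [|y [|z s']] //= _; rewrite !inE !negb_or => /andP[].
case/and3P=> xy xz _ _; rewrite !eqxx (eq_sym y) (negPf xy) => eq_zx.
by rewrite eq_zx eqxx in xz.
Qed.

(** Rotating [s] so that [z] comes first leaves a path through all other vertices, and [f] is
    constant along it. A Boolean [f] stands for a vertex cut, so connectedness applies directly to a
    set given by a predicate. *)
Lemma ham_cycle_minus_connected z (f : G -> bool) :
  (forall x y, x != z -> y != z -> [set x; y] \in C -> f x = f y) ->
  forall x y, x != z -> y != z -> f x = f y.
Proof.
case: hamC => s [_ s_uniq s_all _ defC] f_const.
have [i s' def_s] := rot_to (s_all z).
have := cycle_next s_uniq; rewrite -(rot_cycle i) def_s /=.
have memP x : x != z -> x \in s'.
  by move=> xz; have := s_all x; rewrite -(mem_rot i) def_s inE (negPf xz).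
case: s' def_s memP => [|w s'] def_s memP.
  by move=> _ x y /memP; rewrite in_nil.
rewrite /= rcons_path => /and3P[_ w_path _].
have : z \notin w :: s'.
  by have := s_uniq; rewrite -(rot_uniq i) def_s => /andP[].
have f_w : forall w, z \notin w :: s' -> path (frel (next s)) w s' ->
    forall x, x \in w :: s' -> f x = f w.
  elim: (s') => [|v t IHt] u /=; first by move=> _ _ x; rewrite inE => /eqP->.
  rewrite inE negb_or => /andP[zu zt] /andP[/eqP def_v v_path] x.
  have f_vu : f v = f u.
    rewrite eq_sym in zu; have := zt; rewrite inE negb_or eq_sym => /andP[vz _].
    apply/esym/f_const => //.
    by rewrite defC -def_v; apply: imset_f; apply: s_all.
  rewrite inE => /predU1P[->//|x_t].
  by rewrite -f_vu; apply: IHt.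
by move=> zs x y /memP/(f_w _ zs w_path)-> /memP/(f_w _ zs w_path)->.
Qed.

End HamiltonCycle.

(** Each cycle of [D] uses two edges at [x], and distinct cycles use distinct edges; together they
    account for the whole degree of [x], so no edge at [x] is missed. *)
Lemma decomposition_cover (G : sgraph) (D : {set {set {set G}}}) d (x : G) :
    hamilton_decomposition D -> #|[set y | adj x y]| = d.*2 ->
  #|D| = d /\ forall y, adj x y -> exists2 C, C \in D & [set x; y] \in C.
Proof.
case=> m [deg_m cardD /trivIsetP trivD hamD] deg_x.
(* The degree of [x] is even, which excludes the odd regular case. *)
have def_d : m = d by case: deg_m => /(_ x); rewrite deg_x; lia.
subst d; split=> // y xy.
pose N (C : {set {set G}}) := [set z | [set x; z] \in C].
(* Empty outside [D], so that the sets are disjoint for all pairs of distinct indices, not only for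
   those in [D]. *)
pose F C := if C \in D then N C else set0.
have F_disj C1 C2 : C1 != C2 -> [disjoint F C1 & F C2].
  rewrite /F => neqC; case: ifP => C1D; last first.
    by rewrite disjoints_subset sub0set.
  case: ifP => C2D; last by rewrite disjoint_sym disjoints_subset sub0set.
  apply/pred0P=> z; rewrite /= !inE.
  by have /pred0P/(_ [set x; z]) := trivD _ _ C1D C2D neqC.
have cardF : #|\bigcup_(C in D) F C| = m.*2.
  have := partition_disjoint_bigcup addn (fun=> 1) F_disj.
  rewrite sum1_card => cardU.
  transitivity #|\bigcup_C F C|.
    apply: eq_card => z; apply/bigcupP/bigcupP=> [[C _ zC]|[C _ zC]];
      exists C => //.
    by move: zC; rewrite /F; case: ifP; rewrite ?inE.
  rewrite cardU (bigID (mem D)) /=.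
  rewrite [X in _ + X]big1 => [|C /negPf CD]; last first.
    by rewrite /F CD big_set0.
  rewrite addn0 (eq_bigr (fun=> 2)) ?sum_nat_const ?cardD ?muln2 // => C CD.
  by rewrite sum1_card /F CD (ham_cycle_degree (hamD _ CD)).
have sF : \bigcup_(C in D) F C \subset [set z | adj x z].
  apply/bigcupsP=> C CD; apply/subsetP=> z; rewrite /F CD !inE.
  by move=> zC; apply: (ham_cycle_adj (hamD _ CD)) zC.
have /eqP defU : \bigcup_(C in D) F C == [set z | adj x z].
  by rewrite eqEcard sF cardF deg_x /=.
have : y \in [set z | adj x z] by rewrite inE.
rewrite -defU => /bigcupP[C CD]; rewrite /F CD inE => yC.
by exists C.
Qed.

(** * Connectedness, 2-connectedness and transitions *)

Lemma connected_const (G : sgraph) (r : G) :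
    (forall f : G -> bool, (forall x y, adj x y -> f x = f y) ->
       forall x, f x = f r) ->
  connected G.
Proof.
move=> G_const.
have sym : connect_sym (@adj G) by apply: sym_connect_sym; apply: adj_sym.
rewrite /connected /components -(n_comp_connect sym r).
apply: eq_n_comp_r => x; rewrite !inE.
(* The component of [r], as a Boolean function, is constant along edges, hence is everything. *)
rewrite (G_const (connect (@adj G) r)) ?connect0 // => y z yz.
by apply: same_connect_r => //; apply: connect1.
Qed.

(** Deleting any single vertex leaves no cut without edges across it; this is the form that the
    cycle lemma above also has. *)
Definition biconnected (G : sgraph) : Prop :=
  forall (u : G) (f : G -> bool),
    (forall x y, x != u -> y != u -> adj x y -> f x = f y) ->
  forall x y, x != u -> y != u -> f x = f y.

Section Biconnected.
Variables (G : sgraph) (k : nat).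
Hypotheses (biG : biconnected G) (regG : regular k G) (k_ge3 : 2 < k).

(** A vertex [x] other than [r] has a neighbour [u] other than [r], since its degree exceeds 1;
    deleting [u] still leaves [x] and [r] connected. *)
Lemma biconnected_connected (r : G) : connected G.
Proof.
apply: (@connected_const G r) => f f_const x.
have [->//|xr] := eqVneq x r.
have : 0 < #|[set y | adj x y] :\ r|.
  by have := cardsD1 r [set y | adj x y]; rewrite regG; case: (_ \in _); lia.
case/card_gt0P=> u; rewrite !inE => /andP[ur xu].
apply: (biG (u := u)) => [y z _ _| |]; first exact: f_const.
  by apply: contraTneq xu => ->; rewrite adj_irr.
by rewrite eq_sym.
Qed.

Lemma card_half_edges (u : G) : #|half_edges u| = k.
Proof.
rewrite -(regG u).
rewrite -(card_imset [set y | adj u y] (can_inj (fun y => erefl (u, y).2))).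
apply: eq_card => -[x y]; rewrite !inE /=; apply/andP/imsetP.
  by case=> /eqP-> uy; exists y; rewrite ?inE.
by case=> z; rewrite inE => uz [-> ->].
Qed.

(** As [k] exceeds 2, each of the two new vertices receives at least one half-edge, so both are
    attached to the graph minus [u], which is connected and untouched by the splitting. *)
Lemma biconnected_nonseparating (u : G) (t : {set G * G}) :
  transition u t -> ~ separating u t.
Proof.
case=> tsub t2.
have adj_u (y : G) : adj u y -> y != u.
  by apply: contraTneq => ->; rewrite adj_irr.
have [[v r] /= rt] : exists h, h \in t by apply/card_gt0P; rewrite t2.
have := subsetP tsub _ rt; rewrite inE /= => /andP[/eqP def_v].
rewrite def_v in rt * => {v def_v} ur.
have [[v q]] : exists h, h \in half_edges u :\: t.
  apply/card_gt0P; rewrite cardsDS // card_half_edges t2; lia.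
rewrite !inE /= => /and3P[qt /eqP def_v]; rewrite def_v in qt *.
move=> {v def_v} uq.
rewrite /separating (biconnected_connected u).
suff -> : components (split_graph u t) = 1 by [].
apply: (@connected_const (split_graph u t) (Some r)) => f f_const.
have f_adj x y : adj x y ->
    f (split_end u t (x, y)) = f (split_end u t (y, x)).
  move=> xy; apply: f_const; apply/existsP; exists x; apply/existsP; exists y.
  by rewrite xy !eqxx.
have f_off x : x != u -> f (Some x) = f (Some r).
  move=> xu; apply: (biG (u := u) (f := fun x => f (Some x))) => //; last first.
    exact: adj_u.
  move=> y z yu zu /f_adj.
  by rewrite /split_end /= (negPf yu) (negPf zu).
case=> [x|].
  have [->|] := eqVneq x u; last exact: f_off.
  have := f_adj _ _ uq; rewrite /split_end /= (negPf qt) andbF.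
  by rewrite (negPf (adj_u _ uq)) => ->; apply/f_off/adj_u.
by have := f_adj _ _ ur; rewrite /split_end /= rt eqxx (negPf (adj_u _ ur)).
Qed.

End Biconnected.

(** * Degrees and cuts in line graphs *)

Lemma line_vertexP (G : sgraph) (e : line_graph G) :
  exists x y, adj x y /\ val e = [set x; y].
Proof. by have /imsetP[[x y]] := valP e; rewrite inE; exists x, y. Qed.

Section LineDegree.
Variables (G : sgraph) (k : nat).
Hypothesis regG : regular k G.

Definition star (x : G) : {set {set G}} :=
  [set [set x; y] | y in [set y | adj x y]].

Lemma in_star (x : G) e : (e \in star x) = (e \in edges G) && (x \in e).
Proof.
apply/imsetP/andP => [[y]|[/imsetP[[y z] /=]]].
  rewrite inE => xy ->; split; last by rewrite !inE eqxx.
  by apply/imsetP; exists (x, y); rewrite ?inE.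
rewrite inE /= => yz ->; rewrite !inE => /orP[]/eqP->.
  by exists z; rewrite ?inE.
by exists y; rewrite ?inE 1?adj_sym // setUC.
Qed.

Lemma card_star (x : G) : #|star x| = k.
Proof.
rewrite card_in_imset ?regG // => y z _ _ /set2_eq.
by case=> [[]//|[-> ->]].
Qed.

(** The stars of the two ends of [e] have [k] edges each and share only [e], which itself is not
    counted: [k + k - 1 - 1]. *)
Lemma line_degree (e : line_graph G) : #|[set g | adj e g]| = k.-1.*2.
Proof.
have [x [y [xy def_e]]] := line_vertexP e.
rewrite -(card_imset _ val_inj).
have -> : val @: [set g : line_graph G | adj e g]
    = (star x :|: star y) :\ val e.
  apply/setP=> g; rewrite in_setD1; apply/imsetP/andP.
    case=> h; rewrite inE /= /line_adj -val_eqE => /andP[eh /set0Pn[z]].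
    rewrite def_e !inE => /andP[zxy zh] ->.
    split; [by rewrite eq_sym | rewrite !in_star (valP h) /=].
    by case/orP: zxy => /eqP <-; rewrite zh ?orbT.
  case=> ge gxy.
  have gE : g \in edges G.
    by case/setUP: gxy; rewrite in_star => /andP[].
  exists (Sub g gE : line_vertex G) => //.
  rewrite inE /= /line_adj -val_eqE /= eq_sym ge; apply/set0Pn.
  case/setUP: gxy; rewrite in_star => /andP[_ zg]; [exists x|exists y];
    by rewrite inE def_e zg !inE eqxx ?orbT.
have eI : star x :&: star y = [set val e].
  apply/setP=> g; rewrite !inE !in_star; apply/idP/eqP=> [|->].
    case/andP=> /andP[/imsetP[[z w] _ ->] /= xzw] /andP[_ yzw].
    rewrite def_e; move: xzw yzw; rewrite !inE => xzw yzw.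
    have neq_xy : x != y by apply: contraTneq xy => ->; rewrite adj_irr.
    case/orP: xzw neq_xy => /eqP->; case/orP: yzw => /eqP->; rewrite ?eqxx //.
    by rewrite setUC.
  by rewrite (valP e) def_e !inE !eqxx ?orbT.
have eU : val e \in star x :|: star y.
  by rewrite inE in_star (valP e) def_e !inE eqxx.
transitivity #|star x :|: star y|.-1.
  by rewrite [in RHS](cardsD1 (val e)) eU.
have := cardsUI (star x) (star y); rewrite eI cards1 !card_star; lia.
Qed.

End LineDegree.

Section LineGraph.
Variable G : sgraph.

Lemma mem_edges (x y : G) : adj x y -> [set x; y] \in edges G.
Proof. by move=> xy; apply/imsetP; exists (x, y); rewrite ?inE. Qed.

Definition line_of (x y : G) (xy : adj x y) : line_graph G :=
  Sub [set x; y] (mem_edges xy).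

(** Turns a step of the line graph that leaves the edges inside [A] into an edge of [G] that leaves
    [A]: the common end [v] of [e] and [g] lies in [A], so the other end of [g] does not. *)
Lemma line_boundary (A : {set G}) (e g : line_graph G) :
    adj e g -> val e \subset A -> ~~ (val g \subset A) ->
  exists v w, [/\ v \in A, w \notin A, adj v w, v \in val e
    & val g = [set v; w]].
Proof.
case/andP=> _ /set0Pn[z /setIP[ze zg]] /subsetP eA.
have [x [y [xy def_g]]] := line_vertexP g.
have zA := eA z ze; move: zg; rewrite def_g subUset !sub1set.
case/set2P=> def_z; rewrite def_z in zA ze *; rewrite zA ?andbT => out.
  by exists x, y.
by exists y, x; rewrite setUC adj_sym.
Qed.
End LineGraph.

(** * The necklace and its 2-connectedness *)

Section Necklace.
Variable n : nat.
Implicit Types (l i j : 'I_n.+3) (b : bool).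

(** Here [n.+3] is the degree [k], which is both the number of ring positions and the order of a
    clique; a gadget has [k + 1] vertices, and the Boolean tells the two gadgets of a hub apart. *)
Definition bead : finType := ('I_n.+3 * option ('I_n.+3 + bool * 'I_n.+4))%type.
Definition hub l : bead := (l, None).
Definition clique l (y : 'I_n.+3) : bead := (l, Some (inl y)).
Definition gadget l b (x : 'I_n.+4) : bead := (l, Some (inr (b, x))).

(* The missing edge of a gadget joins its vertices 0 and 1; vertex 0 is joined
   to the hub and vertex 1 to the next clique, at clique vertex 0 or 1 according to
   which of the two gadgets it is. *)
Definition bead_adj : rel bead := fun v w =>
  match v, w with
  | (l, None), (m, Some (inl y)) | (m, Some (inl y)), (l, None) =>
      (l == m) && (1 < y)
  | (l, Some (inl y)), (m, Some (inl z)) => (l == m) && (y != z)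
  | (l, None), (m, Some (inr (_, x))) | (m, Some (inr (_, x))), (l, None) =>
      (l == m) && (x == 0 :> nat)
  | (l, Some (inr (b, x))), (m, Some (inl y))
  | (m, Some (inl y)), (l, Some (inr (b, x))) =>
      [&& m == ordS l, x == 1 :> nat & y == b :> nat]
  | (l, Some (inr (b, x))), (m, Some (inr (c, z))) =>
      [&& l == m, b == c, x != z & x + z != 1]
  | (_, None), (_, None) => false
  end.

Lemma bead_adj_sym : symmetric bead_adj.
Proof.
move=> [l [[y|[b x]]|]] [m [[z|[c t]]|]] //=.
  by rewrite eq_sym (eq_sym y).
by rewrite eq_sym (eq_sym b) (eq_sym x) addnC.
Qed.

Lemma bead_adj_irr : irreflexive bead_adj.
Proof. by move=> [l [[y|[b x]]|]] //=; rewrite !eqxx ?andbF. Qed.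

Definition necklace : sgraph := SGraph bead_adj_sym bead_adj_irr.

Definition gate b : 'I_n.+3 := inord b.
Definition port0 : 'I_n.+4 := ord0.
Definition port1 : 'I_n.+4 := inord 1.

Lemma gateE b : gate b = b :> nat. Proof. by rewrite inordK //; case: b. Qed.
Lemma port1E : port1 = 1 :> nat. Proof. by rewrite inordK. Qed.

Lemma eq_gate (y : 'I_n.+3) b : (y == b :> nat) = (y == gate b).
Proof. by rewrite -val_eqE /= gateE. Qed.

Lemma eq_port1 (x : 'I_n.+4) : (x == 1 :> nat) = (x == port1).
Proof. by rewrite -val_eqE /= port1E. Qed.

Lemma ordS_iter d l : iter d (@ordS _) l = (l + d) %% n.+3 :> nat.
Proof.
elim: d => [|d IHd]; first by rewrite addn0 modn_small.
by rewrite iterS /= IHd addnS -(addn1 (_ %% _)) -(addn1 (l + d)) modnDml.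
Qed.

Lemma neq_iter_ordS d l : 0 < d < n.+3 -> iter d (@ordS _) l != l.
Proof.
case/andP=> d_gt0 d_lt; rewrite -val_eqE /= ordS_iter.
rewrite -[X in _ == X](modn_small (ltn_ord l)) -[in X in _ == X](addn0 l).
by rewrite eqn_modDl mod0n modn_small // -lt0n.
Qed.

Lemma ordS_iterP l0 l :
  l != l0 -> exists2 d, 0 < d < n.+3 & l = iter d (@ordS _) l0.
Proof.
rewrite -val_eqE /= => neq_l.
have [l_lt l0_lt] := (ltn_ord l, ltn_ord l0).
have [lt_l|le_l] := ltnP l0 l.
  exists (l - l0); first by lia.
  by apply: val_inj; rewrite /= ordS_iter subnKC 1?ltnW // modn_small.
exists (l + n.+3 - l0); first by lia.
apply: val_inj; rewrite /= ordS_iter subnKC; last by lia.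
by rewrite modnDr modn_small.
Qed.

(** Beads not containing the deleted vertex [w] are connected inside and each is linked to the next,
    so they form a connected chain. The rest of the damaged bead hangs on this chain: its clique on
    the preceding bead, its gadgets and hub on the following one. *)
Lemma necklace_biconnected : biconnected necklace.
Proof.
move=> w f f_const.
have f_clique l y z : clique l y != w -> clique l z != w ->
    f (clique l y) = f (clique l z).
  have [->//|yz] := eqVneq y z; move=> yw zw.
  by apply: f_const => //=; rewrite eqxx.
have f_gadget l b x y : gadget l b x != w -> gadget l b y != w ->
    f (gadget l b x) = f (gadget l b y).
  have [->//|xy] := eqVneq x y; move=> xw yw.
  have [xy1|] := eqVneq (x + y) 1; last first.
    by move=> xy1; apply: f_const => //=; rewrite !eqxx xy xy1.
  (* The two ports are not adjacent, but both are adjacent to 2 and 3, one of which survives. *)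
  have [z zw z_gt1] : exists2 z, gadget l b z != w & 1 < z.
    pose z2 : 'I_n.+4 := inord 2; pose z3 : 'I_n.+4 := inord 3.
    have [z2E z3E] : z2 = 2 :> nat /\ z3 = 3 :> nat by rewrite !inordK.
    have [def_w|] := eqVneq (gadget l b z2) w; last by exists z2; rewrite ?z2E.
    exists z3; last by rewrite z3E.
    by rewrite -def_w; apply/eqP => -[] /(congr1 val) /=; rewrite z2E z3E.
  by transitivity (f (gadget l b z)); apply: f_const;
    rewrite //= !eqxx -val_eqE /=; lia.
have f_hub_gadget l b : hub l != w -> gadget l b port0 != w ->
    f (gadget l b port0) = f (hub l).
  by move=> lw bw; apply: f_const => //=; rewrite !eqxx.
have f_exit l b : gadget l b port1 != w -> clique (ordS l) (gate b) != w ->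
    f (clique (ordS l) (gate b)) = f (gadget l b port1).
  by move=> bw yw; apply: f_const => //=; rewrite gateE port1E !eqxx.
have in_bead v : v.1 != w.1 -> v != w by apply: contraNneq => ->.
have f_bead v : v.1 != w.1 -> f v = f (hub v.1).
  case: v => l [[y|[b x]]|] //= lw.
    rewrite (f_clique l y ord_max) ?in_bead //.
    by apply: f_const; rewrite ?in_bead //= !eqxx.
  by rewrite (f_gadget l b x port0) ?in_bead // f_hub_gadget ?in_bead.
have f_next l y : l != w.1 -> clique (ordS l) y != w ->
    f (clique (ordS l) y) = f (hub l).
  move=> lw yw.
  (* The next clique is entered at two gates, and [w] is at most one of them. *)
  have [b bw] : exists b, clique (ordS l) (gate b) != w.
    have [def_w|] := eqVneq (clique (ordS l) (gate true)) w; last first.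
      by exists true.
    exists false; rewrite -def_w; apply/eqP => -[] /(congr1 val) /=.
    by rewrite !gateE.
  rewrite (f_clique _ y (gate b)) // f_exit //; last exact: in_bead.
  exact: (f_bead (gadget l b port1)).
(* The chain of intact beads starts right after the bead of [w]; an induction on the distance
   carries this value along it. *)
pose c := f (hub (ordS w.1)).
have f_hub l : l != w.1 -> f (hub l) = c.
  case/ordS_iterP=> d /andP[d_gt0 d_lt] ->.
  elim: d d_gt0 d_lt => // -[//|d] IHd _ d_lt.
  rewrite -IHd //; last exact: ltnW.
  have neq_w m : 0 < m < n.+3 -> iter m (@ordS _) w.1 != w.1.
    exact: neq_iter_ordS.
  rewrite -(f_next (iter d.+1 _ _) ord_max) ?neq_w //; last 2 first.
  - exact: ltnW.
  - exact/in_bead/(neq_w d.+2).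
  by rewrite (f_bead (clique _ _)) //=; apply: (neq_w d.+2).
have ordS_neq l : ordS l != l by apply: (@neq_iter_ordS 1).
have f_port1 b : gadget w.1 b port1 != w -> f (gadget w.1 b port1) = c.
  have exit_w : clique (ordS w.1) (gate b) != w by rewrite in_bead /=.
  by move=> bw; rewrite -f_exit // f_bead /= ?ordS_neq.
have f_wclique y : clique w.1 y != w -> f (clique w.1 y) = c.
  have pred_neq : ord_pred w.1 != w.1.
    by rewrite -{2}(ord_predK w.1) eq_sym.
  by rewrite -{1 2}(ord_predK w.1) => yw; rewrite f_next // f_hub.
have f_whub : hub w.1 != w -> f (hub w.1) = c.
  move=> hw.
  (* One of the two gadgets avoids [w] and leads from the hub to the next bead. *)
  have [b bw] : exists b, forall x, gadget w.1 b x != w.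
    case: (w) => l [[y|[b x]]|].
    - by exists true => x; apply/eqP.
    - by exists (~~ b) => z; apply/eqP => -[]; case: (b).
    - by exists true => x; apply/eqP.
  by rewrite -(f_hub_gadget _ b) // (f_gadget _ _ _ port1) // f_port1.
suff f_c v : v != w -> f v = c by move=> x y /f_c-> /f_c->.
move=> vw; have [v1|] := eqVneq v.1 w.1; last first.
  by move=> v1; rewrite f_bead ?f_hub.
case: v v1 vw => l [[y|[b x]]|] /= ->; [exact: f_wclique| |exact: f_whub].
(* When [w] is [port1] of this gadget, the way out is through [port0] and the hub instead. *)
move=> xw; have [def_w|bw] := eqVneq (gadget w.1 b port1) w; last first.
  by rewrite (f_gadget _ _ _ port1) ?f_port1.
have b0w : gadget w.1 b port0 != w.
  by rewrite -def_w; apply/eqP => -[] /(congr1 val); rewrite /= port1E.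
have hw : hub w.1 != w by rewrite -def_w; apply/eqP.
by rewrite (f_gadget _ _ _ port0) // f_hub_gadget ?f_whub.
Qed.

(** * Regularity of the necklace *)

Lemma clique_inj l : injective (clique l). Proof. by move=> y z []. Qed.
Lemma gadget_inj l b : injective (gadget l b). Proof. by move=> x z []. Qed.

Lemma card_nbr (T S : finType) (t : T) (g : S -> T) (A : {set S}) :
  injective g -> (forall x, t != g x) -> #|t |: g @: A| = #|A|.+1.
Proof.
move=> g_inj tg; rewrite cardsU1 card_imset //.
by case: imsetP => // -[x _ def_t]; have := tg x; rewrite def_t eqxx.
Qed.

Lemma card_clique_nbr l y :
  #|[set v : necklace | bead_adj (clique l y) v]| = n.+3.
Proof.
(* The only neighbour outside the clique: the hub, or for the gates 0 and 1 a gadget of the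
   preceding bead. *)
pose t : bead :=
  if 1 < y then hub l else gadget (ord_pred l) (y == 1 :> nat) port1.
rewrite (_ : [set v | _] = t |: clique l @: [set~ y]).
  rewrite card_nbr ?cardsC1 ?card_ord //; first exact: clique_inj.
  by move=> z; apply/eqP; rewrite /t; case: ifP.
apply/setP=> v; apply/idP/setU1P; last first.
  case=> [->|/imsetP[z zy ->]]; rewrite inE /= /t; last first.
    by rewrite !inE eq_sym in zy; rewrite eqxx.
  case: ltnP => /= [y_gt1|]; first by rewrite eqxx.
  rewrite ord_predK eqxx port1E /=.
  by case: (y : nat) => [|[]].
rewrite inE; case: v => m [[z|[c x]]|] /=.
- by case/andP=> /eqP<- yz; right; apply: imset_f; rewrite !inE eq_sym.
- rewrite eq_port1 => /and3P[/eqP def_l /eqP-> /eqP def_y]; left.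
  by rewrite /t def_y def_l ordSK; case: (c).
- by case/andP=> /eqP-> y_gt1; left; rewrite /t y_gt1.
Qed.

Lemma card_gadget_nbr l b x :
  #|[set v : necklace | bead_adj (gadget l b x) v]| = n.+3.
Proof.
have gI := @gadget_inj l b.
have [x_gt1|x_le1] := ltnP 1 x.
  rewrite (_ : [set v | _] = gadget l b @: [set~ x]).
    by rewrite card_imset // cardsC1 card_ord.
  apply/setP=> v; apply/idP/imsetP; last first.
    by case=> z; rewrite !inE => zx -> /=; rewrite !eqxx eq_sym zx /=; lia.
  rewrite inE; case: v => m [[z|[c z]]|] /=; [lia| |lia].
  by case/and4P=> /eqP<- /eqP<- xz _; exists z; rewrite // !inE eq_sym.
(* A port lacks the other port as a neighbour, and [t] makes up for it. *)
pose t : bead := if x == 0 :> nat then hub l else clique (ordS l) (gate b).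
rewrite (_ : [set v | _] = t |: gadget l b @: ~: [set port0; port1]).
  rewrite card_nbr //; last by move=> z; apply/eqP; rewrite /t; case: ifP.
  by rewrite cardsCs setCK cards2 card_ord -val_eqE /= port1E.
apply/setP=> v; apply/idP/setU1P; last first.
  case=> [->|/imsetP[z zy ->]]; rewrite inE /= /t; last first.
    move: zy; rewrite !inE -eq_port1 -!val_eqE /= !eqxx; lia.
  case: eqP => /= [_|]; first by rewrite !eqxx.
  by rewrite gateE !eqxx /=; lia.
rewrite inE; case: v => m [[z|[c z]]|] /=.
- by rewrite eq_gate => /and3P[/eqP-> /eqP x1 /eqP->]; left; rewrite /t x1.
- case/and4P=> /eqP<- /eqP<- xz xz1; right; apply: imset_f.
  by move: xz; rewrite !inE -eq_port1 -!val_eqE /=; lia.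
- by case/andP=> /eqP-> x0; left; rewrite /t x0.
Qed.

Lemma card_hub_nbr l : #|[set v : necklace | bead_adj (hub l) v]| = n.+3.
Proof.
rewrite (_ : [set v | _] = gadget l true port0 |: (gadget l false port0 |:
    clique l @: ~: [set gate false; gate true])).
  rewrite cardsU1 (card_nbr _ (@clique_inj l)) => [|z]; last exact/eqP.
  rewrite cardsCs setCK cards2 card_ord -val_eqE /= !gateE /= in_setU1 negb_or.
  by case: imsetP => [[]//|_]; case: eqP => // -[].
apply/setP=> v; apply/idP/setU1P; last first.
  case=> [->|/setU1P[->|/imsetP[z zy ->]]]; rewrite inE /= !eqxx //=.
  by move: zy; rewrite !inE -!eq_gate /=; lia.
rewrite inE; case: v => m [[z|[c x]]|] //=.
  case/andP=> /eqP-> z_gt1; right; apply/setU1P; right; apply: imset_f.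
  by rewrite !inE -!eq_gate /=; lia.
case/andP=> /eqP-> x0; have -> : x = port0 by apply/val_inj/eqP.
by case: c; [left | right; apply/setU1P; left].
Qed.

Lemma necklace_regular : regular n.+3 necklace.
Proof.
case=> l [[y|[b x]]|].
- exact: card_clique_nbr.
- exact: card_gadget_nbr.
- exact: card_hub_nbr.
Qed.

(** * The 2-edge-cuts around the gadgets *)

Lemma arm_adj l b : adj (hub l : necklace) (gadget l b port0).
Proof. by rewrite /= eqxx. Qed.

Lemma exit_adj l b :
  adj (gadget l b port1 : necklace) (clique (ordS l) (gate b)).
Proof. by rewrite /= port1E gateE !eqxx. Qed.

Definition arm l b : line_graph necklace := line_of (arm_adj l b).
Definition exit l b : line_graph necklace := line_of (exit_adj l b).
Definition core l b : {set necklace} := gadget l b @: setT.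

Lemma core_boundary l b (v w : necklace) :
    v \in core l b -> w \notin core l b -> adj v w ->
  v = gadget l b port0 /\ w = hub l \/
  v = gadget l b port1 /\ w = clique (ordS l) (gate b).
Proof.
case/imsetP=> x _ ->; case: w => m [[z|[c z]]|] /= w_out.
- by rewrite eq_port1 eq_gate => /and3P[/eqP-> /eqP-> /eqP->]; right.
- by case/and4P=> /eqP def_m /eqP def_c; rewrite def_m def_c imset_f in w_out.
- case/andP=> /eqP-> x0; left; split=> //.
  by congr (gadget _ _ _); apply/val_inj/eqP.
Qed.

(** * Hamilton cycles of the line graph of the necklace *)

Section HamiltonCycleOfLine.
Variable C : {set {set line_graph necklace}}.
Hypothesis hamC : hamilton_cycle C.

(* Otherwise the edges of the core, linked to the rest of L(X) by the arm and
   the exit only, would be cut off once the exit is removed. *)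
Lemma arm_straight l b :
  exists2 e : line_graph necklace,
    val e \subset core l b & [set arm l b; e] \in C.
Proof.
have [/existsP[e /andP[eP eC]]|] :=
  boolP [exists e : line_graph necklace,
    (val e \subset core l b) && ([set arm l b; e] \in C)].
  by exists e.
rewrite negb_exists => /forallP no_e; exfalso.
have inner_adj : adj (gadget l b port0 : necklace) (gadget l b (inord 2)).
  by rewrite /= !eqxx -val_eqE /= inordK.
have port0_core : gadget l b port0 \in core l b by apply: imset_f.
have port1_core : gadget l b port1 \in core l b by apply: imset_f.
have hub_core : hub l \notin core l b by apply/imsetP => -[].
have clique_core m y : clique m y \notin core l b by apply/imsetP => -[].
have inner_core : val (line_of inner_adj) \subset core l b.
  by rewrite subUset !sub1set port0_core imset_f.
have arm_core : val (arm l b) \subset core l b = false.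
  by rewrite subUset !sub1set (negPf hub_core).
have exit_core : val (exit l b) \subset core l b = false.
  by rewrite subUset !sub1set (negPf (clique_core _ _)) andbF.
suff : (val (line_of inner_adj) \subset core l b)
    = (val (arm l b) \subset core l b) by rewrite inner_core arm_core.
apply: (ham_cycle_minus_connected hamC (z := exit l b)
  (f := fun e : line_graph necklace => val e \subset core l b)); last first.
- apply/eqP => /(congr1 val)/setP/(_ (hub l)); rewrite !inE eqxx.
  by move/esym/orP=> -[]/eqP.
- by apply/eqP => eq_exit; rewrite eq_exit exit_core in inner_core.
suff imp (x y : line_graph necklace) : y != exit l b -> [set x; y] \in C ->
    val x \subset core l b -> val y \subset core l b.
  move=> x y xe ye xyC; apply/idP/idP; first exact: imp.
  by apply: imp; rewrite // setUC.
move=> ye xyC x_core; apply: contraNT ye => y_core; apply/eqP.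
have [v [w [v_core w_core vw _ def_y]]] :=
  line_boundary (ham_cycle_adj hamC xyC) x_core y_core.
(* The edge [y] leaving the core is the arm, against [no_e], or the exit. *)
case: (core_boundary v_core w_core vw) => -[def_v def_w].
  have def_arm : y = arm l b by apply: val_inj; rewrite def_y def_v def_w setUC.
  by have := no_e x; rewrite x_core -def_arm setUC xyC.
by apply: val_inj; rewrite def_y def_v def_w.
Qed.

(** The arm has only two neighbours in [C]: one lies in its core by [arm_straight], and the other is
    the twin arm. Thus [C] joins it to no other edge at the hub. *)
Lemma arm_turn l b (e : line_graph necklace) :
    [set arm l b; arm l (~~ b)] \in C -> [set arm l b; e] \in C ->
  e = arm l (~~ b) \/ val e \subset core l b.
Proof.
move=> turnC eC; have [g g_core gC] := arm_straight l b.
have neq_g : arm l (~~ b) != g.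
  apply/eqP=> def_g; move: g_core; rewrite -def_g subUset !sub1set.
  by case/andP=> /imsetP[].
have := ham_cycle_degree hamC (arm l b).
pose N := [set g; arm l (~~ b)].
have : N \subset [set y | [set arm l b; y] \in C].
  by rewrite subUset !sub1set !inE gC turnC.
rewrite subEproper => /predU1P[defN _|/proper_card]; last first.
  by rewrite cards2 eq_sym neq_g => /[swap] ->.
have : e \in N by rewrite defN inE.
by case/set2P=> ->; [right | left].
Qed.

(** Cuts the ring open before clique 0; the order within a bead is clique, hub, gadgets, and every
    edge but the wrap-around links changes the rank by at most one. *)
Definition rank (v : necklace) : nat :=
  match v with
  | (l, Some (inl _)) => 3 * l
  | (l, None) => (3 * l).+1
  | (l, Some (inr _)) => (3 * l).+2
  end.

(* The vertices from hub i to hub j, both included; for i < j this part of the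
   ring does not contain the link from the last gadgets to clique 0. *)
Definition segment i j : {set necklace} :=
  [set v | 3 * i < rank v <= (3 * j).+1].

Lemma val_ordS l : ordS l = (if l == ord_max then 0 else l.+1) :> nat.
Proof.
rewrite /= -val_eqE /=; case: eqP => [->|]; first by rewrite modnn.
by have := ltn_ord l; move=> l_lt neq_l; rewrite modn_small //; lia.
Qed.

(** The wrap-around links have both ends outside the segment. Every other edge changes the rank by
    at most one, so it can leave only from hub [i] downwards or from hub [j] upwards. *)
Lemma segment_boundary i j (v w : necklace) :
    adj v w -> v \in segment i j -> w \notin segment i j ->
  v = hub i /\ (exists y, w = clique i y) \/
  v = hub j /\ (exists b, w = gadget j b port0).
Proof.
rewrite !inE.
case: v w => [l [[y|[b x]]|]] [m [[z|[c t]]|]] //=.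
- by case/andP=> /eqP-> _; lia.
- case/and3P=> /eqP-> _ _; have := val_ordS m; rewrite -val_eqE /=.
  by have := (ltn_ord i); have := (ltn_ord j); case: eqP; lia.
- by case/andP=> /eqP-> _; lia.
- case/and3P=> /eqP-> _ _; have := val_ordS l; rewrite -val_eqE /=.
  by have := (ltn_ord i); have := (ltn_ord j); case: eqP; lia.
- by case/and4P=> /eqP-> _ _ _; lia.
- by case/andP=> /eqP-> _; lia.
- case/andP=> /eqP-> _ lP lN; left.
  have -> : m = i by apply: val_inj => /=; lia.
  by split=> //; exists z.
- case/andP=> /eqP-> t0 lP lN; right.
  have -> : m = j by apply: val_inj => /=; lia.
  split=> //; exists c; congr (gadget _ _ _); exact/val_inj/eqP.
Qed.

Lemma segment_hub_arm i j (e : line_graph necklace) :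
  hub i \in val e -> val e \subset segment i j -> exists b, e = arm i b.
Proof.
have hub_arm (v : necklace) : val e = [set hub i; v] ->
    adj (hub i : necklace) v -> val e \subset segment i j -> exists b, e = arm i b.
  move=> def_e; rewrite def_e subUset !sub1set => iv /andP[_].
  case: v iv def_e => m [[y|[b x]]|] //= /andP[/eqP<-].
    by rewrite inE /=; lia.
  move=> /eqP x0 def_e _; exists b; apply/val_inj/(etrans def_e).
  by have -> : x = port0 by apply: val_inj.
have [v [w [vw def_e]]] := line_vertexP e.
move=> hub_e e_in; move: (hub_e); rewrite def_e => /set2P[]def_hub.
  by apply: (hub_arm w); rewrite ?def_hub.
by apply: (hub_arm v); rewrite ?def_hub 1?setUC 1?adj_sym.
Qed.

(** With turns at both hubs, [C] never passes between edges inside the segment and the others: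
    [arm_turn] forbids the passage from an arm of hub [i] to a clique edge, and from an edge of the
    segment at hub [j] to an arm of that hub. Yet the arms of [i] lie inside and those of [j] do
    not. *)
Lemma turn_unique i j :
    [set arm i false; arm i true] \in C ->
    [set arm j false; arm j true] \in C ->
  ~~ (i < j).
Proof.
move=> turn_i turn_j; apply/negP=> lt_ij.
have turnC l b : [set arm l false; arm l true] \in C ->
    [set arm l b; arm l (~~ b)] \in C by case: b => //; rewrite setUC.
have hub_core m l b : hub m \notin core l b by apply/imsetP => -[].
have clique_core m y l b : clique m y \notin core l b by apply/imsetP => -[].
have hub_i : hub i \in segment i j by rewrite inE /=; lia.
(* The strict inequality [i < j] matters here: the gadgets at [i] have rank [3 * i + 2]. *)
have arm_i : val (arm i true) \subset segment i j.
  by rewrite subUset !sub1set hub_i inE /=; lia.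
have gadget_j b x : gadget j b x \notin segment i j by rewrite inE /=; lia.
have arm_j b : val (arm j b) \subset segment i j = false.
  by rewrite subUset !sub1set (negPf (gadget_j _ _)) andbF.
suff : (val (arm i true) \subset segment i j)
    = (val (arm j true) \subset segment i j) by rewrite arm_i arm_j.
apply: (ham_cycle_minus_connected hamC (z := arm j false)
  (f := fun e : line_graph necklace => val e \subset segment i j)); last first.
- apply/eqP => /(congr1 val)/setP/(_ (gadget j true port0)); rewrite !inE eqxx.
  by rewrite orbT => /esym/orP[]/eqP.
- by apply/eqP => eq_arm; rewrite eq_arm arm_j in arm_i.
suff imp (x y : line_graph necklace) : [set x; y] \in C ->
    val x \subset segment i j -> val y \subset segment i j.
  move=> x y _ _ xyC; apply/idP/idP; first exact: imp.
  by apply: imp; rewrite // setUC.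
move=> xyC x_in; apply: contraT => y_out.
have [v [w [v_in w_out vw vx def_y]]] :=
  line_boundary (ham_cycle_adj hamC xyC) x_in y_out.
case: (segment_boundary vw v_in w_out) => -[def_v [z def_w]].
  have [b def_x] : exists b, x = arm i b.
    by rewrite def_v in vx; apply: (segment_hub_arm vx x_in).
  have ye : clique i z \in val y by rewrite def_y def_w !inE eqxx orbT.
  rewrite def_x in xyC.
  case: (arm_turn (turnC _ _ turn_i) xyC) => [def_y'|/subsetP/(_ _ ye)].
    by move: ye; rewrite def_y' => /set2P[].
  by rewrite (negPf (clique_core _ _ _ _)).
have def_arm : y = arm j z by apply: val_inj; rewrite def_y def_v def_w.
rewrite def_arm setUC in xyC.
case: (arm_turn (turnC _ _ turn_j) xyC) => [def_x|/subsetP/(_ _ vx)].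
  by rewrite def_x arm_j in x_in.
by rewrite def_v (negPf (hub_core _ _ _)).
Qed.

End HamiltonCycleOfLine.

Lemma necklace_not_decomposable (D : {set {set {set line_graph necklace}}}) :
  ~ hamilton_decomposition D.
Proof.
move=> decD.
have deg (e : line_graph necklace) := line_degree necklace_regular e.
have [cardD _] := decomposition_cover decD (deg (arm ord0 true)).
have turn_cycle i : exists C : {set {set line_graph necklace}},
    (C \in D) && ([set arm i false; arm i true] \in C).
  have [_ cover] := decomposition_cover decD (deg (arm i false)).
  have arms_adj : adj (arm i false) (arm i true).
    apply/andP; split; last first.
      by apply/set0Pn; exists (hub i); rewrite !inE eqxx.
    apply/eqP => /(congr1 val)/setP/(_ (gadget i true port0)).
    by rewrite !inE eqxx orbT => /orP[]/eqP.
  by have [C CD turnC] := cover _ arms_adj; exists C; rewrite CD.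
(* Sends each hub to a cycle that turns there; there are [n.+3] hubs but only [n.+2] cycles. *)
pose F i := xchoose (turn_cycle i).
have F_D i : F i \in D by case/andP: (xchooseP (turn_cycle i)).
have F_turn i : [set arm i false; arm i true] \in F i.
  by case/andP: (xchooseP (turn_cycle i)).
have [F_inj|] := boolP (injectiveb F).
  have : #|F @: setT| <= #|D|.
    by apply/subset_leq_card/subsetP=> _ /imsetP[i _ ->].
  by rewrite card_imset ?cardsT ?card_ord ?cardD ?ltnn //; apply/injectiveP.
case/injectivePn=> i [j neq_ij eqF].
have [_ [_ _ _ /(_ _ (F_D i)) hamF]] := decD.
have turn_j := F_turn j; rewrite -eqF in turn_j.
(* Applied in both orders, as either of the two hubs may come first. *)
have := turn_unique hamF (F_turn i) turn_j.
have := turn_unique hamF turn_j (F_turn i).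
by case: ltngtP neq_ij => // /val_inj->; rewrite eqxx.
Qed.

End Necklace.

Theorem theorem1 (k : nat) (hk : 3 <= k) :
  exists X : sgraph,
    [/\ connected X,
        regular k X,
        forall (u : X) (t : {set X * X}), transition u t -> ~ separating u t
      & ~ exists D : {set {set {set line_graph X}}},
            hamilton_decomposition D].
Proof.
case: k hk => [|[|[|n]]] // k_ge3; exists (necklace n).
have biN := @necklace_biconnected n; have regN := @necklace_regular n.
split=> //.
- exact: (biconnected_connected biN regN k_ge3 (hub ord0)).
- exact: (biconnected_nonseparating biN regN k_ge3).
- by case=> D; apply: necklace_not_decomposable.
Qed.
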